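(* Let $P$ be the condensation measure associated with the uniform distribution $\nu$ on $[\frac25,\frac35]$, and let $D(P)$ be its quantization dimension. The $D(P)$-dimensional lower and upper quantization coefficients for $P$ are finite and positive, i.e., $0<\liminf_{n\to\infty}n^{2/D(P)}V_n(P)\le\limsup_{n\to\infty}n^{2/D(P)}V_n(P)<\infty$.
   Context: Let $\nu$ be the uniform distribution on $[\frac25,\frac35]\subset\mathbb R$. Let $S_1(x)=\frac15x$ and $S_2(x)=\frac15x+\frac45$ for $x\in\mathbb R$. The condensation measure $P$ associated with $\nu$ is the unique Borel probability measure on $\mathbb R$ with $P=\frac13P\circ S_1^{-1}+\frac13P\circ S_2^{-1}+\frac13\nu$. For a Borel probability measure $\mu$ on $\mathbb R$ the $n$th quantization error (of order $2$) is $V_n(\mu)=\inf\{\int\min_{a\in\alpha}(x-a)^2\,d\mu(x):\alpha\subseteq\mathbb R,\ 1\le\mathrm{card}(\alpha)\le n\}$. The quantization dimension is $D(\mu)=\lim_{n\to\infty}\frac{2\log n}{-\log V_n(\mu)}$ when the limit exists; for $P$ it exists and $D(P)=1$. For $s>0$ the $s$-dimensional lower and upper quantization coefficients of $\mu$ are $\liminf_n n^{2/s}V_n(\mu)$ and $\limsup_n n^{2/s}V_n(\mu)$. *)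

(* Defs.v *)
From HB Require Import structures.
From mathcomp Require Import all_boot all_order all_algebra finmap.
From mathcomp Require Import all_classical all_reals all_analysis.

Set Implicit Arguments.
Unset Strict Implicit.
Unset Printing Implicit Defensive.

Import Order.TTheory GRing.Theory Num.Theory.
Import numFieldNormedType.Exports.

Local Open Scope fset_scope.
Local Open Scope classical_set_scope.
Local Open Scope ring_scope.

Definition S1 (R : realType) (x : R) : R := 5^-1 * x.

Definition S2 (R : realType) (x : R) : R := 5^-1 * x + 4 / 5.

Lemma lt_2div5_3div5 (R : realType) : (2 / 5 : R) < 3 / 5.
Proof. by rewrite ltr_pM2r ?invr_gt0 ?ltr0n// ltr_nat. Qed.

Definition nu (R : realType) : probability (measurableTypeR R) R :=
  uniform_prob (lt_2div5_3div5 R).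

(* Equality of Borel measures is equality on Borel sets: the values of a
   measure on non-measurable sets are unspecified. *)
Definition is_condensation_measure (R : realType)
    (P : probability (measurableTypeR R) R) : Prop :=
  forall A : set (measurableTypeR R), measurable A ->
    P A = ((3^-1)%:E * pushforward P (@S1 R) A
         + (3^-1)%:E * pushforward P (@S2 R) A
         + (3^-1)%:E * nu R A)%E.

(* The minimum is taken in \bar R, where +oo is neutral for mine; for a
   nonempty alpha it is the usual real minimum. *)
Definition distortion (R : realType) (mu : probability (measurableTypeR R) R)
    (alpha : {fset R}) : \bar R :=
  (\int[mu]_x \big[mine/+oo]_(a <- alpha) ((x - a) ^+ 2)%:E)%E.

Definition quantization_error (R : realType)
    (mu : probability (measurableTypeR R) R) (n : nat) : \bar R :=
  ereal_inf [set distortion mu alpha |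
    alpha in [set alpha : {fset R} | (1 <= #|` alpha| <= n)%N]].

(* lim and fine are total: this is meaningful when the limit exists and the
   quantization errors are finite for n >= 1, which is the case as soon as mu
   has a finite second moment. *)
Definition quantization_dim (R : realType)
    (mu : probability (measurableTypeR R) R) : R :=
  lim ((2 * ln n%:R) / (- ln (fine (quantization_error mu n))) @[n --> \oo]).

Definition lower_quantization_coef (R : realType)
    (mu : probability (measurableTypeR R) R) (s : R) : \bar R :=
  limn_einf (fun n : nat =>
    ((n%:R `^ (2 / s))%:E * quantization_error mu n)%E).

Definition upper_quantization_coef (R : realType)
    (mu : probability (measurableTypeR R) R) (s : R) : \bar R :=
  limn_esup (fun n : nat =>
    ((n%:R `^ (2 / s))%:E * quantization_error mu n)%E).

(* Main.v *)
Require Import Defs.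
From HB Require Import structures.
From mathcomp Require Import all_boot all_order all_algebra finmap.
From mathcomp Require Import all_classical all_reals all_analysis.
From mathcomp Require Import measurable_realfun ring lra zify.

(** The theorem follows from the two-sided estimate
    [1 / (2400 n^2) <= V_n(P) <= 64 / n^2] for [n >= 2]: taking logarithms, it
    forces [D(P) = 1], and then it bounds [n^(2 / D(P)) V_n(P) = n^2 V_n(P)]
    between two positive constants.

    Lower bound. The condensation identity gives [P >= nu / 3], and [nu] has
    density at most 5. The points within distance [d] of an [n]-point codebook
    thus carry [nu]-mass at most [10 n d], which is one half for
    [d = 1 / (20 n)]; the remaining points carry [P]-mass at least [1 / 6] and
    each contributes at least [d^2] to the distortion
    ([condensation_distortion_ge]).

    Upper bound. From a codebook [alpha], build
    [beta = S1(alpha) U S2(alpha) U grid], where the grid is a [1/m]-net of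
    [[2/5, 3/5]]. Integrating against the condensation identity, the two
    contracted copies contribute [2 * (1/3) * (1/25)] times the distortion of
    [alpha], and the grid [1 / (3 m^2)] ([condensation_distortion_step]). With
    [m = 4^(k+1)] at step [k+1], both of the following invariants propagate: the
    codebook has at most [2 * 4^k] points, because the doubling of cardinals is
    slower than the growth of [4^k]; its distortion is at most [16^(-k)],
    because [16 * 2/75 + 1/3 <= 1] ([condensation_codebook]). The grids
    set the rate: copying by [S1] and [S2] multiplies the distortion by [2/75]
    while it only doubles the number of points, so a codebook of [n] points can
    spend most of them on the grids. *)

Set Implicit Arguments.
Unset Strict Implicit.
Unset Printing Implicit Defensive.

Import Order.TTheory GRing.Theory Num.Theory.
Import numFieldNormedType.Exports.

Local Open Scope fset_scope.
Local Open Scope classical_set_scope.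
Local Open Scope ring_scope.

(** * Squared distance to a finite set *)

Section SquaredDistance.
Context {R : realType}.
Implicit Types (s : seq R) (x a : R).

Definition sqdist s x : \bar R := (\big[mine/+oo]_(a <- s) ((x - a) ^+ 2)%:E)%E.

Lemma sqdist_cons a s x :
  sqdist (a :: s) x = mine ((x - a) ^+ 2)%:E (sqdist s x).
Proof. by rewrite /sqdist big_cons. Qed.

Lemma sqdist_ge s x (c : \bar R) :
  (forall a, a \in s -> (c <= ((x - a) ^+ 2)%:E)%E) -> (c <= sqdist s x)%E.
Proof.
elim: s => [|a s IH] h; first by rewrite /sqdist big_nil leey.
rewrite sqdist_cons le_min h ?mem_head//= IH// => b bs.
by apply: h; rewrite inE bs orbT.
Qed.

Lemma sqdist_le s x a : a \in s -> (sqdist s x <= ((x - a) ^+ 2)%:E)%E.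
Proof.
elim: s => [//|b s IH]; rewrite inE sqdist_cons ge_min => /orP[/eqP->|/IH->].
  by rewrite lexx.
by rewrite orbT.
Qed.

Lemma sqdist_attained s x : (0 < size s)%N ->
  exists2 a, a \in s & sqdist s x = ((x - a) ^+ 2)%:E.
Proof.
elim: s => [//|a [|b s] IH] _.
  by exists a; rewrite ?mem_head// sqdist_cons /sqdist big_nil /mine ltry.
have [c cs e] := IH isT; rewrite sqdist_cons e /mine; case: ifP => _.
  by exists a; rewrite ?mem_head.
by exists c => //; rewrite inE cs orbT.
Qed.

Lemma sqdist_ge0 s x : (0 <= sqdist s x)%E.
Proof. by apply: sqdist_ge => a _; rewrite lee_fin sqr_ge0. Qed.

Lemma measurable_sqdist s :
  measurable_fun (setT : set (measurableTypeR R)) (sqdist s).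
Proof.
elim: s => [|a s IH].
  rewrite (_ : sqdist [::] = cst +oo%E)//.
  by apply/funext => x; rewrite /sqdist big_nil.
rewrite (_ : sqdist (a :: s) =
    fun x => mine ((x - a) ^+ 2)%:E (sqdist s x)); last first.
  by apply/funext => x; rewrite sqdist_cons.
apply: measurable_mine => //; apply/measurable_EFinP.
apply: (@measurable_funX _ _ _ _ (fun x : measurableTypeR R => x - a) 2).
exact: measurable_funB.
Qed.

End SquaredDistance.

(** * The condensation identity *)

Section CondensationMeasure.
Context {R : realType}.
Implicit Types f : measurableTypeR R -> \bar R.

Lemma measurable_S1 :
  @measurable_fun _ _ (measurableTypeR R) (measurableTypeR R) setT (@S1 R).
Proof. exact: measurable_funM. Qed.

Lemma measurable_S2 :
  @measurable_fun _ _ (measurableTypeR R) (measurableTypeR R) setT (@S2 R).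
Proof. by apply: measurable_funD => //; exact: measurable_S1. Qed.

Context (P : probability (measurableTypeR R) R).
Hypothesis hP : is_condensation_measure P.

(** The defining identity of [P] on Borel sets, transferred to integrals by
    writing its right-hand side as a sum of scaled image measures. *)
Lemma condensation_integral f :
  measurable_fun setT f -> (forall x, 0 <= f x)%E ->
  (\int[P]_x f x = (3^-1)%:E * \int[P]_x f (S1 x) +
    (3^-1)%:E * \int[P]_x f (S2 x) + (3^-1)%:E * \int[nu R]_x f x)%E.
Proof.
move=> mf f0.
have third_ge0 : 0 <= 3^-1 :> R by rewrite invr_ge0.
pose k : {nonneg R} := NngNum third_ge0.
pose T := measurableTypeR R.
pose S1m : {mfun T >-> T} :=
  HB.pack (@S1 R : T -> T) (isMeasurableFun.Build _ _ T T _ measurable_S1).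
pose S2m : {mfun T >-> T} :=
  HB.pack (@S2 R : T -> T) (isMeasurableFun.Build _ _ T T _ measurable_S2).
pose m1 : {measure set T -> \bar R} :=
  mscale k (distribution P S1m).
pose m2 : {measure set T -> \bar R} :=
  mscale k (distribution P S2m).
pose m3 : {measure set T -> \bar R} := mscale k (nu R).
pose m12 : {measure set T -> \bar R} := measure_add m1 m2.
have m12E A : m12 A = (m1 A + m2 A)%E := measure_addE m1 m2 A.
have Pm A : measurable A -> A `<=` setT -> P A = measure_add m12 m3 A.
  by move=> mA _; rewrite (hP mA) measure_addE m12E.
rewrite (eq_measure_integral (measure_add m12 m3) Pm).
rewrite !ge0_integral_measure_add// !ge0_integral_mscale//=.
rewrite !ge0_integral_pushforward//.
Qed.

Lemma nu_le_condensation A : measurable A -> ((3^-1)%:E * nu R A <= P A)%E.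
Proof.
move=> mA; rewrite hP// leeDr//.
by apply: adde_ge0; apply: mule_ge0; rewrite ?lee_fin ?invr_ge0// /pushforward;
  exact: measure_ge0.
Qed.

Lemma nu_support : nu R (~` `[2 / 5, 3 / 5]%classic) = 0%E.
Proof.
by rewrite /= /uniform_prob integral_uniform_pdf setICl integral_set0.
Qed.

(** If [x] lies outside [[0, 1]] and is [S1 y] or [S2 y], then so does [y];
    as [nu] lives on [[2/5, 3/5]], the mass [p] outside [[0, 1]] satisfies
    [p <= 2/3 p]. *)
Lemma condensation_support : P (~` `[0, 1]%classic) = 0%E.
Proof.
set A := ~` _.
have mA : measurable (A : set (measurableTypeR R)) by exact: measurableC.
have mA1 : measurable (@S1 R @^-1` A : set (measurableTypeR R)).
  by rewrite -[X in measurable X]setTI; apply: measurable_S1.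
have mA2 : measurable (@S2 R @^-1` A : set (measurableTypeR R)).
  by rewrite -[X in measurable X]setTI; apply: measurable_S2.
have le1 : (P (@S1 R @^-1` A) <= P A)%E.
  apply: le_measure; rewrite ?inE// => x.
  rewrite /A /S1 /= !in_itv/= => h /andP[h0 h1].
  by apply: h; apply/andP; split; lra.
have le2 : (P (@S2 R @^-1` A) <= P A)%E.
  apply: le_measure; rewrite ?inE// => x.
  rewrite /A /S2 /= !in_itv/= => h /andP[h0 h1].
  by apply: h; apply/andP; split; lra.
have nuA : nu R A = 0%E.
  apply/eqP; rewrite -measure_le0 -nu_support.
  apply: le_measure; rewrite ?inE//.
    exact: measurableC.
  move=> x; rewrite /A /= !in_itv/= => h /andP[h0 h1].
  by apply: h; apply/andP; split; lra.
have := hP mA; rewrite nuA mule0 adde0 /pushforward.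
move: le1 le2.
have : P A \is a fin_num by exact: fin_num_measure.
have : P (@S1 R @^-1` A) \is a fin_num by exact: fin_num_measure.
have : P (@S2 R @^-1` A) \is a fin_num by exact: fin_num_measure.
have : (0 <= P A)%E by exact: measure_ge0.
move: (P A) (P (@S1 R @^-1` A)) (P (@S2 R @^-1` A)).
move=> [a| |] [b| |] [c| |]//= a0 _ _ _.
rewrite !lee_fin in a0 *; rewrite -!EFinM -EFinD => ba ca [e].
by congr EFin; lra.
Qed.

End CondensationMeasure.

Lemma probability_integral_le {R : realType}
    (mu : probability (measurableTypeR R) R) (D : set (measurableTypeR R))
    (f : measurableTypeR R -> \bar R) (c : R) :
  measurable D -> mu (~` D) = 0%E -> measurable_fun setT f ->
  (forall x, 0 <= f x)%E -> (0 <= c) -> (forall x, D x -> f x <= c%:E)%E ->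
  (\int[mu]_x f x <= c%:E)%E.
Proof.
move=> mD muD mf f0 c0 fc.
have -> : c%:E = (\int[mu]_x (cst c%:E) x)%E.
  rewrite integral_cst// -[LHS]mule1; congr (_ * _)%E.
  by apply/esym; exact: probability_setT.
apply: ae_ge0_le_integral => //.
exists (~` D); split => //; first exact: measurableC.
by move=> x /= h Dx; apply: h => _; exact: fc.
Qed.

(** * Lower bound on the distortion *)

Section LowerBound.
Context {R : realType}.

Lemma nu_le_lebesgue (A : set (measurableTypeR R)) : measurable A ->
  (nu R A <= 5%:E * (@lebesgue_measure R) A)%E.
Proof.
move=> mA; rewrite -integral_cst//; apply: ge0_le_integral => //=.
- by move=> x _; rewrite lee_fin uniform_pdf_ge0// lt_2div5_3div5.
- apply/measurable_EFinP.
  by apply: measurable_funS (measurable_uniform_pdf _ _).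
- have pdf5 : (3 / 5 - 2 / 5)^-1 = 5 :> R by field.
  by move=> x _; rewrite lee_fin /uniform_pdf; case: ifP; rewrite ?pdf5.
Qed.

(** [B] is the union of the closed intervals of radius [d] around the points of
    [s], each of which has [nu]-mass at most [5 * 2 d]. *)
Lemma nu_nbhs_le (s : seq R) (d : R) : 0 <= d ->
  exists B : set (measurableTypeR R), [/\ measurable B,
    (nu R B <= (10 * d * (size s)%:R)%:E)%E &
    forall x, ~ B x -> ((d ^+ 2)%:E <= sqdist s x)%E].
Proof.
move=> d0; elim: s => [|a s [B [mB nuB dB]]].
  by exists set0; split => [//||x _]; rewrite ?measure0 ?mulr0// sqdist_ge.
pose I : set (measurableTypeR R) := `[a - d, a + d]%classic.
have mI : measurable I by exact: measurable_itv.
have nuI : (nu R I <= (10 * d)%:E)%E.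
  apply: le_trans (nu_le_lebesgue mI) _.
  rewrite /I lebesgue_measure_itv/= lte_fin; case: ifP => _.
    by rewrite -EFinD -EFinM lee_fin; lra.
  by rewrite mule0 lee_fin mulr_ge0.
exists (I `|` B); split; first exact: measurableU.
  apply: le_trans (measureU2 _ mI mB) _.
  apply: le_trans (leeD nuI nuB) _.
  by rewrite -EFinD lee_fin/= -natr1; lra.
move=> x /not_orP[nI nB]; rewrite sqdist_cons le_min dB// andbT lee_fin.
have {nI} : ~~ (x \in `[a - d, a + d]) by apply/negP.
rewrite in_itv/= negb_and -!ltNge => /orP[h|h]; nra.
Qed.

(** Markov inequality at the radius [d = 1 / (20 n)], for which the
    [d]-neighbourhood of the codebook has [nu]-mass at most one half. *)
Lemma condensation_distortion_ge (P : probability (measurableTypeR R) R)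
    (alpha : {fset R}) (n : nat) : is_condensation_measure P ->
  (0 < n)%N -> (#|` alpha| <= n)%N ->
  (((2400 * n%:R ^+ 2)^-1)%:E <= distortion P alpha)%E.
Proof.
move=> hP n0 cn.
have n0' : 0 < n%:R :> R by rewrite ltr0n.
pose d : R := (20 * n%:R)^-1.
have d0 : 0 < d by rewrite invr_gt0 mulr_gt0.
have dn : 20 * n%:R * d = 1 by rewrite mulfV// gt_eqF// mulr_gt0.
have [B [mB nuB dB]] := nu_nbhs_le alpha (ltW d0).
have mC : measurable (~` B) by exact: measurableC.
have nuC : ((2^-1)%:E <= nu R (~` B))%E.
  rewrite probability_setC// leeBrDl; last exact: fin_num_measure.
  apply: (@le_trans _ _ ((2^-1)%:E + (2^-1)%:E)%E); last first.
    by rewrite -EFinD lee_fin; lra.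
  apply: leeD => //; apply: le_trans nuB _; rewrite lee_fin.
  have : (size alpha)%:R <= n%:R :> R by rewrite ler_nat.
  nra.
have PC : ((6^-1)%:E <= P (~` B))%E.
  apply: le_trans (nu_le_condensation hP mC).
  apply: (@le_trans _ _ ((3^-1)%:E * (2^-1)%:E)%E).
    by rewrite -EFinM lee_fin; lra.
  by apply: lee_wpmul2l.
apply: (@le_trans _ _ (\int[P]_(x in ~` B) cst (d ^+ 2)%:E x)%E).
  rewrite integral_cst//.
  apply: (@le_trans _ _ ((d ^+ 2)%:E * (6^-1)%:E)%E).
    rewrite -EFinM lee_fin (_ : (2400 * _)^-1 = d ^+ 2 * 6^-1)//.
    by rewrite /d; field; rewrite gt_eqF.
  by apply: lee_wpmul2l => //; rewrite lee_fin sqr_ge0.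
apply: (@le_trans _ _ (\int[P]_(x in ~` B) sqdist alpha x)%E).
  apply: ge0_le_integral => //.
  - by move=> x _; rewrite lee_fin sqr_ge0.
  - by apply: measurable_funTS; exact: measurable_sqdist.
apply: ge0_subset_integral => //; first exact: measurable_sqdist.
by move=> x _; exact: sqdist_ge0.
Qed.

End LowerBound.

(** * Upper bound on the quantization error *)

Section UpperBound.
Context {R : realType}.

(** The progression covers the unit interval to the right of [2/5], five times
    the length of the support of [nu]: the bounds hold up to constant factors,
    and the mesh [1/m] gives the simplest estimates. *)
Definition grid (m : nat) : {fset R} :=
  [fset x in [seq (2 / 5 + i%:R / m%:R)%R | i <- iota 0 m]]%fset.

Lemma card_grid m : (#|` grid m| <= m)%N.
Proof.
by rewrite card_fseq (leq_trans (size_undup _))// size_map size_iota.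
Qed.

Lemma sqdist_grid m x : (0 < m)%N -> 2 / 5 <= x <= 3 / 5 ->
  (sqdist (grid m) x <= ((m%:R^-1) ^+ 2)%:E)%E.
Proof.
move=> m0 /andP[x0 x1].
have m0' : 0 < m%:R :> R by rewrite ltr0n.
have y0 : 0 <= m%:R * (x - 2 / 5) by apply: mulr_ge0; lra.
have /andP[i0 i1] := truncn_itv y0.
move: (Num.truncn _) i0 i1 => i i0 i1.
have im : (i < m)%N.
  rewrite -(ltr_nat R); apply: le_lt_trans i0 _.
  nra.
apply: (le_trans (sqdist_le _ (a := 2 / 5 + i%:R / m%:R) _)).
  by rewrite in_fset; apply: map_f; rewrite mem_iota.
rewrite lee_fin -natr1 in i1 *.
have -> : x - (2 / 5 + i%:R / m%:R) = (m%:R * (x - 2 / 5) - i%:R) / m%:R.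
  by field; rewrite gt_eqF.
rewrite expr_div_n -exprVn ler_piMl ?sqr_ge0// expr_le1//; lra.
Qed.

(** A nearest point to [x] in [s] is mapped, with [x], by a similarity of ratio
    [r]. *)
Lemma sqdist_contraction (s t : seq R) (r b x : R) : (0 < size s)%N ->
  {in s, forall a, r * a + b \in t} ->
  (sqdist t (r * x + b) <= (r ^+ 2)%:E * sqdist s x)%E.
Proof.
move=> s0 st; have [a as_ ->] := sqdist_attained x s0.
apply: le_trans (sqdist_le _ (st _ as_)) _.
rewrite -EFinM lee_fin -exprMn (_ : r * x + b - _ = r * (x - a))//; ring.
Qed.

Lemma distortion_contraction (mu : probability (measurableTypeR R) R)
    (alpha : {fset R}) (t : seq R) (r b : R) : (0 < #|` alpha|)%N ->
  {in alpha, forall a, r * a + b \in t} ->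
  (\int[mu]_x sqdist t (r * x + b) <= (r ^+ 2)%:E * distortion mu alpha)%E.
Proof.
move=> alpha0 ht.
have m1 : measurable_fun (setT : set (measurableTypeR R)) (sqdist alpha).
  exact: measurable_sqdist.
have m2 : @measurable_fun _ _ (measurableTypeR R) (measurableTypeR R) setT
    (fun x => r * x + b).
  by apply: measurable_funD => //; exact: measurable_funM.
rewrite -ge0_integralZl//; last 2 first.
- by move=> x _; exact: sqdist_ge0.
- by rewrite lee_fin sqr_ge0.
apply: ge0_le_integral => //.
- by move=> x _; exact: sqdist_ge0.
- exact: (measurableT_comp (measurable_sqdist t) m2).
- exact: measurable_funeM.
- by move=> x _; exact: sqdist_contraction.
Qed.

Variables (P : probability (measurableTypeR R) R).
Hypothesis hP : is_condensation_measure P.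

(** Each of the three parts of [P] is served by its own part of the new
    codebook; [2 / 75] is [2 * (1/3) * (1/25)]. *)
Lemma condensation_distortion_step (alpha : {fset R}) (m : nat) :
  (0 < #|` alpha|)%N -> (0 < m)%N ->
  (distortion P ((@S1 R @` alpha) `|` (@S2 R @` alpha) `|` grid m)%fset <=
   (2 / 75)%:E * distortion P alpha + (3^-1 * m%:R^-1 ^+ 2)%:E)%E.
Proof.
move=> alpha0 m0; set beta := (_ `|` _)%fset.
have le1 : (\int[P]_x sqdist beta (S1 x) <=
    (5^-1 ^+ 2)%:E * distortion P alpha)%E.
  have -> : @S1 R = fun x => 5^-1 * x + 0 by apply/funext => x; rewrite addr0.
  apply: distortion_contraction => // a aa.
  by rewrite addr0 !in_fsetU [_ \in (@S1 R @` _)%fset]in_imfset.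
have le2 : (\int[P]_x sqdist beta (S2 x) <=
    (5^-1 ^+ 2)%:E * distortion P alpha)%E.
  apply: distortion_contraction => // a aa.
  by rewrite !in_fsetU [_ \in (@S2 R @` _)%fset]in_imfset ?orbT.
have le3 : (\int[nu R]_x sqdist beta x <= (m%:R^-1 ^+ 2)%:E)%E.
  apply: (probability_integral_le (D := `[2 / 5, 3 / 5]%classic)) => //.
  - exact: nu_support.
  - exact: measurable_sqdist.
  - by move=> x; exact: sqdist_ge0.
  - move=> x /=; rewrite in_itv/= => /(sqdist_grid m0); apply: le_trans.
    apply: sqdist_ge => a ag; apply: sqdist_le.
    by rewrite in_fsetU ag orbT.
rewrite /distortion -/(sqdist beta) (condensation_integral hP); last 2 first.
- exact: measurable_sqdist.
- by move=> x; exact: sqdist_ge0.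
have third_ge0 : (0 <= (3^-1 : R)%:E)%E by rewrite lee_fin.
have D0 : (0 <= distortion P alpha)%E.
  by apply: integral_ge0 => x _; exact: sqdist_ge0.
apply: (@le_trans _ _ ((3^-1)%:E * ((5^-1 ^+ 2)%:E * distortion P alpha) +
    (3^-1)%:E * ((5^-1 ^+ 2)%:E * distortion P alpha) +
    (3^-1)%:E * (m%:R^-1 ^+ 2)%:E)%E).
  by apply: leeD; [apply: leeD|]; exact: lee_wpmul2l.
rewrite !muleA -!EFinM -ge0_muleDl ?lee_fin; [|lra|lra].
by rewrite -EFinD (_ : 3^-1 * _ + 3^-1 * _ = 2 / 75)//; field.
Qed.

(** Iterating the previous step with a grid of [4^(k+1)] points. The base 4 is a
    choice: a base [q] keeps the cardinals of order [q^k] when [q > 2] and the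
    distortions of order [q^(-2k)] when [2/75 * q^2 < 1]. *)
Lemma condensation_codebook (k : nat) : exists alpha : {fset R},
  (0 < #|` alpha| <= 2 * 4 ^ k)%N /\
  (distortion P alpha <= ((4 ^ k)%:R^-1 ^+ 2)%:E)%E.
Proof.
elim: k => [|k [alpha [/andP[a0 a1] D]]].
  exists [fset 0]%fset; rewrite cardfs1 expn0 invr1 expr1n; split=> //.
  apply: (probability_integral_le (D := `[0, 1]%classic)) => //.
  - exact: condensation_support.
  - exact: measurable_sqdist.
  - by move=> x; exact: sqdist_ge0.
  - move=> x /=; rewrite in_itv/= => /andP[x0 x1].
    apply: (le_trans (sqdist_le x (fset11 0))).
    by rewrite subr0 lee_fin expr_le1.
have k0 : (0 < 4 ^ k.+1)%N by rewrite expn_gt0.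
exists ((@S1 R @` alpha) `|` (@S2 R @` alpha) `|` grid (4 ^ k.+1))%fset.
split.
  apply/andP; split.
    apply: leq_trans (fsubset_leq_card
      (fsubset_trans (fsubsetUl _ _) (fsubsetUl _ _))).
    rewrite cardfs_gt0; move: a0; rewrite cardfs_gt0 => /fset0Pn[a aa].
    by apply/fset0Pn; exists (S1 a); rewrite in_imfset.
  apply: leq_trans (leq_card_fsetU _ _).1 _.
  have h1 : (#|` (@S1 R @` alpha)%fset| <= 2 * 4 ^ k)%N.
    by apply: leq_trans a1; exact: leq_imfset_card.
  have h2 : (#|` (@S2 R @` alpha)%fset| <= 2 * 4 ^ k)%N.
    by apply: leq_trans a1; exact: leq_imfset_card.
  have h12 := leq_trans (leq_card_fsetU (@S1 R @` alpha)%fset _).1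
    (leq_add h1 h2).
  have := leq_add h12 (card_grid (4 ^ k.+1)); rewrite expnS => /leq_trans; apply.
  lia.
apply: le_trans (condensation_distortion_step a0 k0) _.
have c0 : (0 <= (2 / 75 : R)%:E)%E by rewrite lee_fin; lra.
apply: (@le_trans _ _ ((2 / 75)%:E * ((4 ^ k)%:R^-1 ^+ 2)%:E +
    (3^-1 * (4 ^ k.+1)%:R^-1 ^+ 2)%:E)%E).
  by apply: leeD => //; exact: lee_wpmul2l.
rewrite -EFinM -EFinD lee_fin expnS natrM invfM exprMn.
have : 0 <= ((4 ^ k)%:R^-1 : R) ^+ 2 by exact: sqr_ge0.
move: (_ ^+ 2) => z; lra.
Qed.

Lemma condensation_quantization_error_le (n : nat) : (1 < n)%N ->
  (quantization_error P n <= (64 / n%:R ^+ 2)%:E)%E.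
Proof.
move=> n1.
have n0' : 0 < n%:R :> R by rewrite ltr0n (leq_trans _ n1).
(* As [4^k >= n / 8], a distortion [16^(-k)] is at most [64 / n^2]. *)
suff [k [alpha [/andP[a0 an] D nk]]] : exists k, exists alpha : {fset R},
    [/\ (0 < #|` alpha| <= n)%N,
        (distortion P alpha <= ((4 ^ k)%:R^-1 ^+ 2)%:E)%E & (n <= 8 * 4 ^ k)%N].
  apply: (@le_trans _ _ (distortion P alpha)).
    by apply: ereal_inf_lbound; exists alpha => //=; rewrite a0.
  apply: (le_trans D); rewrite lee_fin exprVn.
  rewrite ler_pdivlMr ?exprn_gt0// ler_pdivrMl ?exprn_gt0 ?ltr0n ?expn_gt0//.
  have : n%:R <= 8 * (4 ^ k)%:R :> R by rewrite -natrM ler_nat.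
  nra.
(* The largest [k] for which the codebook fits: [2 * 4^k <= n]. *)
pose k := trunc_log 4 (n %/ 2).
have /andP[k1 k2] : (4 ^ k <= n %/ 2 < 4 ^ k.+1)%N.
  by apply: trunc_log_bounds => //; rewrite divn_gt0.
have [alpha [/andP[a0 an] D]] := condensation_codebook k.
exists k, alpha; split => //.
  rewrite a0 (leq_trans an)//; lia.
rewrite expnS in k2; lia.
Qed.

End UpperBound.

(** * Dimension and coefficients under inverse square decay *)

Section InverseSquareDecay.
Context {R : realType}.

Lemma cvg_ln_nat : (ln (n%:R : R)) @[n --> \oo] --> +oo.
Proof.
apply/cvgryPge => A; near=> n.
rewrite -(expRK A) ler_ln ?posrE ?expR_gt0//; last first.
  by apply: lt_le_trans (expR_gt0 A) _; near: n; exact: nbhs_infty_ger.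
by near: n; exact: nbhs_infty_ger.
Unshelve. all: by end_near. Qed.

Context (mu : probability (measurableTypeR R) R) (c C : R).
Hypothesis c0 : 0 < c.
Hypothesis V_ge : forall n, (1 < n)%N ->
  ((c / n%:R ^+ 2)%:E <= quantization_error mu n)%E.
Hypothesis V_le : forall n, (1 < n)%N ->
  (quantization_error mu n <= (C / n%:R ^+ 2)%:E)%E.

(** [- ln V_n] differs from [2 ln n] by a bounded quantity, hence the quotient
    [- ln V_n / (2 ln n)], which is easier to squeeze than its inverse, tends
    to 1. *)
Lemma quantization_dim_eq1 : quantization_dim mu = 1.
Proof.
pose b n : R := - ln (fine (quantization_error mu n)) / (2 * ln n%:R).
have cvgb (x : R) : 1 - x / 2 * (ln n%:R)^-1 @[n --> \oo] --> (1 : R).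
  rewrite -[X in _ --> X](_ : 1 - x / 2 * 0 = 1); last by rewrite mulr0 subr0.
  apply: cvgB; first exact: cvg_cst.
  apply: cvgM; first exact: cvg_cst.
  apply/gtr0_cvgV0; last exact: cvg_ln_nat.
  by near=> n; rewrite ln_gt0// ltr1n; near: n; exists 2%N.
have b1 : b n @[n --> \oo] --> (1 : R).
  apply: squeeze_cvgr (cvgb (ln C)) (cvgb (ln c)).
  near=> n.
  have n1 : (1 < n)%N by near: n; exists 2%N.
  have n0 : 0 < n%:R :> R by rewrite ltr0n ltnW.
  have ln0 : 0 < ln (n%:R : R) by rewrite ln_gt0// ltr1n.
  have := V_le n1; have := V_ge n1; rewrite /b.
  case: (quantization_error mu n) => [v| |]//=; rewrite !lee_fin => cv vC.
  have v0 : 0 < v by apply: lt_le_trans cv; rewrite divr_gt0// exprn_gt0.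
  have C0 : 0 < C.
    have : 0 < C / n%:R ^+ 2 by exact: lt_le_trans v0 vC.
    by rewrite pmulr_lgt0// invr_gt0 exprn_gt0.
  have lnx (x : R) : 0 < x -> ln (x / n%:R ^+ 2) = ln x - 2 * ln n%:R.
    by move=> x0; rewrite ln_div ?posrE ?exprn_gt0// lnXn// mulr_natl.
  have lnv_ge : ln c - 2 * ln n%:R <= ln v.
    by rewrite -lnx// ler_ln// posrE divr_gt0// exprn_gt0.
  have lnv_le : ln v <= ln C - 2 * ln n%:R.
    by rewrite -lnx// ler_ln// posrE divr_gt0// exprn_gt0.
  have E (x : R) : 1 - x / 2 * (ln n%:R)^-1 = (2 * ln n%:R - x) / (2 * ln n%:R).
    by field; rewrite gt_eqF.
  by rewrite !E !ler_pM2r ?invr_gt0 ?mulr_gt0//; apply/andP; split; lra.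
apply/cvg_lim => //.
rewrite (_ : (fun n : nat => _) = (fun n => (b n)^-1)); last first.
  by apply/funext => n; rewrite /b invf_div.
by rewrite -[X in _ --> X]invr1; exact: cvgV.
Unshelve. all: by end_near. Qed.

Lemma le_rescaled n : (1 < n)%N ->
  (c%:E <= (n%:R `^ (2 / 1))%:E * quantization_error mu n)%E.
Proof.
move=> n1; have n0 : 0 < n%:R :> R by rewrite ltr0n ltnW.
rewrite divr1 powR_mulrn ?ler0n//.
apply: (@le_trans _ _ ((n%:R ^+ 2)%:E * (c / n%:R ^+ 2)%:E)%E).
  by rewrite -EFinM lee_fin mulrC divfK// gt_eqF// exprn_gt0.
by apply: lee_wpmul2l; [rewrite lee_fin sqr_ge0|exact: V_ge].
Qed.

Lemma rescaled_le n : (1 < n)%N ->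
  ((n%:R `^ (2 / 1))%:E * quantization_error mu n <= C%:E)%E.
Proof.
move=> n1; have n0 : 0 < n%:R :> R by rewrite ltr0n ltnW.
rewrite divr1 powR_mulrn ?ler0n//.
apply: (@le_trans _ _ ((n%:R ^+ 2)%:E * (C / n%:R ^+ 2)%:E)%E).
  by apply: lee_wpmul2l; [rewrite lee_fin sqr_ge0|exact: V_le].
by rewrite -EFinM lee_fin mulrC divfK// gt_eqF// exprn_gt0.
Qed.

Lemma lower_quantization_coef_ge : (c%:E <= lower_quantization_coef mu 1)%E.
Proof.
rewrite /lower_quantization_coef limn_einf_lim.
apply: lime_ge; first exact: is_cvg_einfs.
near=> m; apply: le_ereal_inf_tmp => _ [k /= mk <-].
by apply: le_rescaled; apply: leq_trans mk; near: m; exists 2%N.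
Unshelve. all: by end_near. Qed.

Lemma upper_quantization_coef_le : (upper_quantization_coef mu 1 <= C%:E)%E.
Proof.
rewrite /upper_quantization_coef limn_esup_lim.
apply: lime_le; first exact: is_cvg_esups.
near=> m; apply: ge_ereal_sup => _ [k /= mk <-].
by apply: rescaled_le; apply: leq_trans mk; near: m; exists 2%N.
Unshelve. all: by end_near. Qed.

End InverseSquareDecay.

(** * Quantization coefficients of the condensation measure *)

Local Open Scope ereal_scope.

Theorem theorem4p11p3 (R : realType) (P : probability (measurableTypeR R) R)
    (hP : is_condensation_measure P) :
  0 < lower_quantization_coef P (quantization_dim P) /\
  lower_quantization_coef P (quantization_dim P) <=
    upper_quantization_coef P (quantization_dim P) /\
  upper_quantization_coef P (quantization_dim P) < +oo.
Proof.
have c0 : (0 < 2400^-1 :> R)%R by rewrite invr_gt0 ltr0n.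
have V_ge n : (1 < n)%N ->
    (2400^-1 / n%:R ^+ 2)%:E <= quantization_error P n.
  move=> n1; apply: le_ereal_inf_tmp => _ [alpha /= /andP[_ an] <-].
  by rewrite -invfM; apply: condensation_distortion_ge => //; exact: ltnW.
have V_le := condensation_quantization_error_le hP.
rewrite (quantization_dim_eq1 c0 V_ge V_le).
split; last split.
- by apply: lt_le_trans (lower_quantization_coef_ge V_ge); rewrite lte_fin.
- exact: limn_einf_sup.
- by apply: le_lt_trans (upper_quantization_coef_le V_le) _; rewrite ltry.
Qed.
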